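(* Let $r\ge1$, $M\ge2$, and let $v$ be the dimension of the free nilpotent Lie algebra $\mathfrak{g}_{M,r}$ with $M$ generators and nilpotent of step $r$. Consider $v$ independent copies of operators $A_j,A_j^*$, $j=1,\dots,v$, satisfying the canonical commutation relations $[A_j,A_k^*]=\delta_{jk}\,\mathrm{id}$ and $[A_j,A_k]=0=[A_j^*,A_k^*]$. Then the operators $$E_1=A_1,$$ $$E_l=A_l+\sum_{j\succ l}\frac{(-1)^{d(j)-d(l)}}{(I(j)-I(l))!}\,(A_1^* )^{c_1^{(j)}-c_1^{(l)}}(A_2^* )^{c_2^{(j)}-c_2^{(l)}}\cdots(A_v^* )^{c_v^{(j)}-c_v^{(l)}}A_j,\qquad l=2,\dots,M,$$ generate (under commutators) a Lie algebra isomorphic to $\mathfrak{g}_{M,r}$.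
   Context: Free nilpotent Lie algebra: $\mathfrak{g}_{M,r}$ is a Lie algebra generated by elements $F_1,\dots,F_M$, nilpotent of step $r$ (iterated brackets of more than $r$ elements vanish), such that every map from $\{F_1,\dots,F_M\}$ to a Lie algebra $\mathfrak{n}$ nilpotent of step $r$ extends uniquely to a Lie algebra homomorphism $\mathfrak{g}_{M,r}\to\mathfrak{n}$. Hall basis of $\mathfrak{g}_{M,r}$: defined recursively. The generators are basis elements of length 1. If basis elements of lengths $1,\dots,s-1$ are defined, they are ordered so that $E<F$ whenever $\mathrm{length}(E)<\mathrm{length}(F)$. If $\mathrm{length}(E)+\mathrm{length}(F)=s\ (\le r)$, then $[E,F]$ is a basis element of length $s$ iff (1) $E,F$ are basis elements and $E>F$, and (2) if $E=[G,H]$ then $F\ge H$. Number the Hall basis in this order as $H_1,\dots,H_v$, with $H_1,\dots,H_M$ the generators. For $i>M$ write $H_i=[H_{j_1},H_{k_1}]$ with $j_1>k_1$ and, keeping $H_{k_1}$ fixed, repeatedly expand the left factor, to obtain $H_i=[[\cdots[[H_{j_n},H_{k_n}],H_{k_{n-1}}],\cdots,H_{k_2}],H_{k_1}]$ with $1\le k_n<j_n\le M$ and $k_{l+1}\le k_l$ for $1\le l\le n-1$. Set $d(i)=n$ and let $I(i)=(c_1^{(i)},\dots,c_v^{(i)})$ with $c_s^{(i)}=\#\{t:k_t=s\}$. For $1\le i\le M$ set $d(i)=0$ and $I(i)=(0,\dots,0)$. $H_i$ is called a direct descendant of each $H_{j_l}$ occurring in this expansion, written $j_l\prec i$ (equivalently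 $i\succ j_l$). For a multi-index, $(c_1,\dots,c_v)!=\prod_s c_s!$. The operators $A_j,A_j^*$ are annihilation/creation operators acting on a common dense invariant domain (e.g. finite linear combinations of the product basis vectors, where in each factor $Ae_n=\sqrt n\,e_{n-1}$, $A^*e_n=\sqrt{n+1}\,e_{n+1}$). *)

(* Defs.v *)
From HB Require Import structures.
From mathcomp Require Import all_boot all_order all_algebra.
From mathcomp Require Import boolp classical_sets functions.

Set Implicit Arguments.
Unset Strict Implicit.
Unset Printing Implicit Defensive.

Import GRing.Theory.
Local Open Scope ring_scope.
Local Open Scope classical_set_scope.

(* Bracketed words with letters in T: [Node t u] stands for the formal        *)
(* bracket [t, u], and [tree_length t] is the number of letters of t.         *)
Inductive btree (T : Type) : Type := Leaf of T | Node of btree T & btree T.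

Section BtreeChoice.
Variable T : Type.

Fixpoint btree_encode (t : btree T) : GenTree.tree T :=
  match t with
  | Leaf x => GenTree.Leaf x
  | Node t1 t2 => GenTree.Node 0 [:: btree_encode t1; btree_encode t2]
  end.

Fixpoint btree_decode (t : GenTree.tree T) : option (btree T) :=
  match t with
  | GenTree.Leaf x => Some (Leaf x)
  | GenTree.Node _ [:: t1; t2] =>
      if (btree_decode t1, btree_decode t2) is (Some u1, Some u2)
      then Some (Node u1 u2) else None
  | GenTree.Node _ _ => None
  end.

Lemma btree_encodeK : pcancel btree_encode btree_decode.
Proof. by elim=> [x|t1 IH1 t2 IH2] //=; rewrite IH1 IH2. Qed.

End BtreeChoice.

HB.instance Definition _ (T : eqType) :=
  Equality.copy (btree T) (pcan_type (@btree_encodeK T)).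

Fixpoint tree_length T (t : btree T) : nat :=
  match t with
  | Leaf _ => 1
  | Node t1 t2 => (tree_length t1 + tree_length t2)%N
  end.

HB.mixin Record Lmodule_isLieAlgebra (K : comNzRingType) L
    of GRing.Lmodule K L := {
  bracket : L -> L -> L;
  bracket_linear_l : forall y, linear (fun x => bracket x y);
  bracket_linear_r : forall x, linear (bracket x);
  bracketxx : forall x, bracket x x = 0;
  bracket_jacobi : forall x y z,
    bracket x (bracket y z) + bracket y (bracket z x)
      + bracket z (bracket x y) = 0
}.

#[short(type="lieAlgType")]
HB.structure Definition LieAlgebra (K : comNzRingType) :=
  { L of GRing.Lmodule K L & Lmodule_isLieAlgebra K L }.

Section LieTheory.
Variable K : comNzRingType.
Implicit Types L : lieAlgType K.

Definition lie_subalgebra L (S : set L) : Prop :=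
  [/\ S 0,
      forall a x y, S x -> S y -> S (a *: x + y) &
      forall x y, S x -> S y -> S (bracket x y)].

Definition lie_generated L (G : set L) : set L := smallest (@lie_subalgebra L) G.

Definition lie_hom L L' (f : L -> L') : Prop :=
  linear f /\ forall x y, f (bracket x y) = bracket (f x) (f y).

Fixpoint lie_eval L (t : btree L) : L :=
  match t with
  | Leaf x => x
  | Node t1 t2 => bracket (lie_eval t1) (lie_eval t2)
  end.

Definition nilpotent_of_step (r : nat) L : Prop :=
  forall t : btree L, (r < tree_length t)%N -> lie_eval t = 0.

Definition free_nilpotent (M r : nat) L (F : 'I_M -> L) : Prop :=
  [/\ lie_generated (range F) = [set: L],
      nilpotent_of_step r L &
      forall (N : lieAlgType K) (f : 'I_M -> N), nilpotent_of_step r N ->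
        exists! phi : L -> N, lie_hom phi /\ forall i, phi (F i) = f i].

Definition lie_isomorphic_onto L L' (S : set L') : Prop :=
  exists phi : L -> L', lie_hom phi /\ set_bij [set: L] S phi.

End LieTheory.
Arguments nilpotent_of_step {K} r L.
Arguments free_nilpotent {K M} r {L} F.
Arguments lie_isomorphic_onto {K} L {L'} S.

(* Linear operators from D to itself: a ring for composition, and a Lie       *)
(* algebra for the commutator.                                                *)
Record operator (K : comNzRingType) (D : lmodType K) := Operator {
  op_fun :> D -> D;
  op_linear : linear op_fun
}.

Section OperatorAlgebra.
Variables (K : comNzRingType) (D : lmodType K).
Local Notation op := (operator D).
Implicit Types f g h : op.

HB.instance Definition _ := gen_eqMixin op.
HB.instance Definition _ := gen_choiceMixin op.
HB.instance Definition _ f := GRing.isLinear.Build K D D *:%R f (op_linear f).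

Lemma opP f g : f =1 g -> f = g.
Proof.
case: f g => [f lf] [g lg] /= /funext fg.
by case: g / fg lg => lg; rewrite (Prop_irrelevance lf lg).
Qed.

Fact op0_linear : linear (fun _ : D => 0 : D).
Proof. by move=> a x y; rewrite scaler0 addr0. Qed.
Fact op1_linear : linear (fun x : D => x).
Proof. by []. Qed.
Fact opN_linear f : linear (fun x => - f x).
Proof. by move=> a x y; rewrite linearP opprD scalerN. Qed.
Fact opD_linear f g : linear (fun x => f x + g x).
Proof. by move=> a x y; rewrite !linearP scalerDr addrACA. Qed.
Fact opZ_linear c f : linear (fun x => c *: f x).
Proof. by move=> a x y; rewrite linearP scalerDr !scalerA mulrC. Qed.
Fact opM_linear f g : linear (fun x => f (g x)).
Proof. by move=> a x y; rewrite !linearP. Qed.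

Fact op_addA : associative (fun f g => Operator (opD_linear f g)).
Proof. by move=> f g h; apply: opP => x /=; rewrite addrA. Qed.
Fact op_addC : commutative (fun f g => Operator (opD_linear f g)).
Proof. by move=> f g; apply: opP => x /=; rewrite addrC. Qed.
Fact op_add0 :
  left_id (Operator op0_linear) (fun f g => Operator (opD_linear f g)).
Proof. by move=> f; apply: opP => x /=; rewrite add0r. Qed.
Fact op_addN : left_inverse (Operator op0_linear)
  (fun f => Operator (opN_linear f)) (fun f g => Operator (opD_linear f g)).
Proof. by move=> f; apply: opP => x /=; rewrite addNr. Qed.

HB.instance Definition _ :=
  GRing.isZmodule.Build op op_addA op_addC op_add0 op_addN.

Fact op_mulA : associative (fun f g => Operator (opM_linear f g)).
Proof. by move=> f g h; apply: opP. Qed.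
Fact op_mul1l :
  left_id (Operator op1_linear) (fun f g => Operator (opM_linear f g)).
Proof. by move=> f; apply: opP. Qed.
Fact op_mul1r :
  right_id (Operator op1_linear) (fun f g => Operator (opM_linear f g)).
Proof. by move=> f; apply: opP. Qed.
Fact op_mulDl :
  left_distributive (fun f g => Operator (opM_linear f g)) +%R.
Proof. by move=> f g h; apply: opP. Qed.
Fact op_mulDr :
  right_distributive (fun f g => Operator (opM_linear f g)) +%R.
Proof. by move=> f g h; apply: opP => x /=; rewrite linearD. Qed.

HB.instance Definition _ := GRing.Zmodule_isPzRing.Build op
  op_mulA op_mul1l op_mul1r op_mulDl op_mulDr.

Fact op_scaleA a b f :
  Operator (opZ_linear a (Operator (opZ_linear b f)))
  = Operator (opZ_linear (a * b) f).
Proof. by apply: opP => x /=; rewrite scalerA. Qed.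
Fact op_scale1 : left_id 1 (fun a f => Operator (opZ_linear a f)).
Proof. by move=> f; apply: opP => x /=; rewrite scale1r. Qed.
Fact op_scaleDr :
  right_distributive (fun a f => Operator (opZ_linear a f)) +%R.
Proof. by move=> a f g; apply: opP => x /=; rewrite scalerDr. Qed.
Fact op_scaleDl f : {morph (fun a => Operator (opZ_linear a f)) : a b / a + b}.
Proof. by move=> a b; apply: opP => x /=; rewrite scalerDl. Qed.

HB.instance Definition _ := GRing.Zmodule_isLmodule.Build K op
  op_scaleA op_scale1 op_scaleDr op_scaleDl.

Lemma op_addE f g x : (f + g) x = f x + g x. Proof. by []. Qed.
Lemma op_oppE f x : (- f) x = - f x. Proof. by []. Qed.
Lemma op_scaleE c f x : (c *: f) x = c *: f x. Proof. by []. Qed.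
Lemma op_mulE f g x : (f * g) x = f (g x). Proof. by []. Qed.
Lemma op_oneE x : (1 : op) x = x. Proof. by []. Qed.
Lemma op_zeroE x : (0 : op) x = 0. Proof. by []. Qed.

Definition commutator f g : op := f * g - g * f.

Fact commutator_linear_l g : linear (fun f => commutator f g).
Proof.
move=> a f1 f2; apply: opP => x.
rewrite !(op_addE, op_oppE, op_scaleE, op_mulE) linearP.
by rewrite opprD addrACA scalerBr.
Qed.
Fact commutator_linear_r f : linear (commutator f).
Proof.
move=> a g1 g2; apply: opP => x.
rewrite !(op_addE, op_oppE, op_scaleE, op_mulE) linearP.
by rewrite opprD addrACA scalerBr.
Qed.
Fact commutatorxx f : commutator f f = 0.
Proof. exact: subrr. Qed.
Fact commutator_jacobi f g h :
  commutator f (commutator g h) + commutator g (commutator h f)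
    + commutator h (commutator f g) = 0.
Proof.
rewrite /commutator !mulrBr !mulrBl !mulrA !opprB !addrA.
rewrite [LHS](ACl ((1*12)*(2*7)*(3*10)*(4*5)*(6*11)*(8*9)))%AC /=.
by rewrite ?(subrr, addNr, addr0).
Qed.

HB.instance Definition _ := Lmodule_isLieAlgebra.Build K op
  commutator_linear_l commutator_linear_r commutatorxx commutator_jacobi.

End OperatorAlgebra.

Definition ccr (K : comNzRingType) (D : lmodType K) (v : nat)
    (A Ac : 'I_v -> operator D) : Prop :=
  forall j k, [/\ commutator (A j) (Ac k) = (j == k)%:R,
                  commutator (A j) (A k) = 0 &
                  commutator (Ac j) (Ac k) = 0].

Section Hall.
Variables (M r : nat).
Implicit Types (H : seq (btree 'I_M)) (t : btree 'I_M).

Definition hall_rule H t : bool :=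
  match t with
  | Leaf _ => true
  | Node E F =>
      [&& (tree_length E + tree_length F <= r)%N, E \in H, F \in H,
          (index F H < index E H)%N &
          if E is Node _ G then (index G H <= index F H)%N else true]
  end.

(* H lists a Hall basis H_1, ..., H_v, H_i being the entry of index i - 1, so *)
(* that E < F in the Hall order iff index E H < index F H.  The order among   *)
(* elements of equal length >= 2 is arbitrary.                                *)
Definition hall_basis H : Prop :=
  [/\ uniq H,
      sorted leq [seq tree_length t | t <- H],
      take M H = [seq Leaf i | i <- enum 'I_M] &
      forall t, (t \in H) = hall_rule H t].

End Hall.

(* For t = [[..[[t_n, u_n], u_(n-1)],..], u_1] with t_n a letter and          *)
(* t_(l-1) = [t_l, u_l] (t_0 := t), left_factors t is [:: t_1; ..; t_n] and   *)
(* right_factors t is [:: u_1; ..; u_n].                                      *)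
Fixpoint left_factors T (t : btree T) : seq (btree T) :=
  if t is Node t1 _ then t1 :: left_factors t1 else [::].
Fixpoint right_factors T (t : btree T) : seq (btree T) :=
  if t is Node t1 u1 then u1 :: right_factors t1 else [::].

Section HallOperators.
Variables (K : numFieldType) (D : lmodType K) (M v : nat).
Variables (H : v.-tuple (btree 'I_M)) (A Ac : 'I_v -> operator D).
Implicit Types j l s : 'I_v.

Definition hall_depth j : nat := size (right_factors (tnth H j)).

Definition hall_mult j s : nat :=
  count_mem (tnth H s) (right_factors (tnth H j)).

(* direct_descendant l j means that H_j is a direct descendant of H_l. *)
Definition direct_descendant l j : bool :=
  tnth H l \in left_factors (tnth H j).

(* The truncated subtractions below are only used for direct_descendant l j,  *)
(* when right_factors (H_l) is a suffix of right_factors (H_j).  The factors  *)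
(* Ac s commute pairwise under [ccr]; \prod takes them in increasing order.   *)
Definition hall_coef j l : K :=
  (-1) ^+ (hall_depth j - hall_depth l)
    / (\prod_(s < v) (hall_mult j s - hall_mult l s)`!)%:R.

Definition hall_operator l : operator D :=
  if (val l == 0)%N then A l
  else A l + \sum_(j < v | direct_descendant l j)
         hall_coef j l
           *: ((\prod_(s < v) Ac s ^+ (hall_mult j s - hall_mult l s)) * A j).

End HallOperators.

(* Main.v *)
Require Import Defs.
From HB Require Import structures.
From mathcomp Require Import all_boot all_order all_algebra zify.
From mathcomp Require Import boolp classical_sets functions.

(* Read A_j as d/dx_j and A_j^* as x_j, with x_j of weight length(H_j).  Then
   E_l is a polynomial vector field, homogeneous of degree -1, so brackets of
   more than r of the E_l vanish and, by universality, F_l |-> E_l extends to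
   a homomorphism from g onto the Lie algebra generated by the E_l.  It maps
   the Hall element H_i to a field whose leading part is d/dx_i; so these v
   images are linearly independent, and the map is injective as dim g = v. *)

Set Implicit Arguments.
Unset Strict Implicit.
Unset Printing Implicit Defensive.

Import GRing.Theory.
Local Open Scope ring_scope.
Local Open Scope classical_set_scope.


(** * Lie subalgebras and homomorphisms *)

Section LieSubalgebraType.
Variables (K : comNzRingType) (L : lieAlgType K) (S : set L).
Hypothesis subS : lie_subalgebra S.

(* The unused proof argument lets the submodule instance below depend on it. *)
Definition lie_mem of lie_subalgebra S : pred L := fun x => `[< S x >].

Fact lie_mem_submod_closed : submod_closed (lie_mem subS).
Proof.
have [S0 SL _] := subS; split=> [|a x y /asboolP Sx /asboolP Sy]; apply/asboolP => //.
exact: SL.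
Qed.

HB.instance Definition _ :=
  GRing.isSubmodClosed.Build K L (lie_mem subS) lie_mem_submod_closed.

Definition lie_sub : Type := {x : L | lie_mem subS x}.
HB.instance Definition _ := [isSub of lie_sub for @sval L (lie_mem subS)].
HB.instance Definition _ := [Choice of lie_sub by <:].
HB.instance Definition _ := [SubChoice_isSubLmodule of lie_sub by <:].

Local Notation sub_val := (val : {linear lie_sub -> L}).

Lemma lie_subP (x : lie_sub) : S (val x).
Proof. exact/asboolP/(valP x). Qed.

Fact lie_sub_bracketP (x y : lie_sub) : lie_mem subS (bracket (val x) (val y)).
Proof. by have [_ _ subSb] := subS; apply/asboolP/subSb; apply: lie_subP. Qed.

Definition lie_sub_bracket (x y : lie_sub) : lie_sub :=
  Sub (bracket (val x) (val y)) (lie_sub_bracketP x y).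

Fact lie_sub_bracket_linear_l y : linear (fun x => lie_sub_bracket x y).
Proof.
by move=> a x z; apply: val_inj; rewrite !(linearP, SubK, bracket_linear_l).
Qed.
Fact lie_sub_bracket_linear_r x : linear (lie_sub_bracket x).
Proof.
by move=> a y z; apply: val_inj; rewrite !(linearP, SubK, bracket_linear_r).
Qed.
Fact lie_sub_bracketxx x : lie_sub_bracket x x = 0.
Proof. by apply: val_inj; rewrite SubK bracketxx (linear0 sub_val). Qed.
Fact lie_sub_jacobi x y z :
  lie_sub_bracket x (lie_sub_bracket y z) + lie_sub_bracket y (lie_sub_bracket z x)
    + lie_sub_bracket z (lie_sub_bracket x y) = 0.
Proof. by apply: val_inj; rewrite !(linearD sub_val, SubK) bracket_jacobi. Qed.

HB.instance Definition _ := Lmodule_isLieAlgebra.Build K lie_sub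
  lie_sub_bracket_linear_l lie_sub_bracket_linear_r
  lie_sub_bracketxx lie_sub_jacobi.

Lemma lie_sub_val_hom : lie_hom (val : lie_sub -> L).
Proof. by split=> [a x y|x y]; [rewrite linearP | rewrite SubK]. Qed.

End LieSubalgebraType.

Section LieHom.
Variable K : comNzRingType.

Lemma lie_generated_subalgebra (L : lieAlgType K) (G : set L) :
  lie_subalgebra (lie_generated G).
Proof.
split=> [|a x y Gx Gy|x y Gx Gy] S [subS GS].
- by case: subS.
- by case: (subS) => _ + _; apply; [apply: Gx|apply: Gy].
- by case: (subS) => _ _; apply; [apply: Gx|apply: Gy].
Qed.

Lemma lie_hom_comp (L1 L2 L3 : lieAlgType K) (f : L2 -> L3) (h : L1 -> L2) :
  lie_hom f -> lie_hom h -> lie_hom (f \o h).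
Proof.
move=> [lf bf] [lh bh]; split=> [a x y|x y] /=; first by rewrite lh lf.
by rewrite bh bf.
Qed.

Lemma lie_hom_image (L L' : lieAlgType K) (f : L -> L') :
  lie_hom f -> lie_subalgebra (range f).
Proof.
move=> [lf bf]; pose fl := GRing.isLinear.Build _ _ _ _ _ lf.
pose g : {linear L -> L'} := HB.pack f fl.
split=> [|a _ _ [x _ <-] [y _ <-]|_ _ [x _ <-] [y _ <-]].
- by exists 0 => //; apply: (linear0 g).
- by exists (a *: x + y) => //; apply: lf.
- by exists (bracket x y) => //; apply: bf.
Qed.

(** Letters are interpreted through [f], so that one Hall tree can be evaluated both in g and among
    the operators. *)
Fixpoint tree_eval T (L : lieAlgType K) (f : T -> L) (t : btree T) : L :=
  match t with
  | Leaf x => f x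
  | Node t1 t2 => bracket (tree_eval f t1) (tree_eval f t2)
  end.

Lemma lie_hom_tree_eval T (L L' : lieAlgType K) (phi : L -> L') (f : T -> L) t :
  lie_hom phi -> phi (tree_eval f t) = tree_eval (phi \o f) t.
Proof. by move=> [_ bphi]; elim: t => //= t1 <- t2 <-; rewrite bphi. Qed.

Lemma lie_evalE (L : lieAlgType K) t : lie_eval t = tree_eval (@id L) t.
Proof. by elim: t => //= t1 -> t2 ->. Qed.

End LieHom.


(** * Polynomial vector fields in creation operators *)

Section PolynomialFields.
Variables (K : comNzRingType) (D : lmodType K) (v : nat).
Variables (A Ac : 'I_v -> operator D).
Hypothesis ccrA : ccr A Ac.
Local Notation op := (operator D).
Implicit Types (a : K) (W : op) (e f : 'I_v -> nat) (p q s : 'I_v).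
Implicit Types C : ('I_v -> nat) -> 'I_v -> Prop.

Lemma op_scalerAl a (x y : op) : a *: (x * y) = (a *: x) * y.
Proof. exact: opP. Qed.
Lemma op_scalerAr a (x y : op) : a *: (x * y) = x * (a *: y).
Proof. by apply: opP => z; rewrite !(op_mulE, op_scaleE) linearZ. Qed.

Lemma commutatorC (x y : op) : commutator x y = - commutator y x.
Proof. by rewrite /commutator opprB. Qed.

Lemma commutator_mulr (x y z : op) :
  commutator x (y * z) = commutator x y * z + y * commutator x z.
Proof. by rewrite /commutator mulrBl mulrBr !mulrA addrA subrK. Qed.

Lemma commutator_comm (x y : op) : GRing.comm x y -> commutator x y = 0.
Proof. by move=> xy; rewrite /commutator xy subrr. Qed.

Definition monomial e : op := \prod_(s < v) Ac s ^+ e s.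
Definition field_term e q : op := monomial e * A q.

Lemma eq_monomial e f : e =1 f -> monomial e = monomial f.
Proof. by move=> ef; apply: eq_bigr => s _; rewrite ef. Qed.

Lemma comm_creation s p : GRing.comm (Ac s) (Ac p).
Proof. by have [_ _ /subr0_eq] := ccrA s p. Qed.

Lemma monomialD e f : monomial (fun s => (e s + f s)%N) = monomial e * monomial f.
Proof.
rewrite /monomial -prodrM_comm; first by apply: eq_bigr => s _; rewrite exprD.
by move=> s p _ _; apply/commrX/commr_sym/commrX/comm_creation.
Qed.

Lemma monomial0 : monomial (fun=> 0%N) = 1.
Proof. by rewrite /monomial big1. Qed.

Lemma monomial1 p : monomial (fun s => s == p : nat) = Ac p.
Proof.
transitivity (\prod_(s < v | s == p) Ac s); last exact: big_pred1_eq.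
rewrite [RHS]big_mkcond.
by apply: eq_bigr => s _; case: (s == p); rewrite ?expr1 ?expr0.
Qed.

Lemma comm_monomial e f : GRing.comm (monomial e) (monomial f).
Proof.
by rewrite /GRing.comm -!monomialD; apply: eq_monomial => s; rewrite addnC.
Qed.

(** [A p] acts as d/dx_p. The induction is on total degree: one creation operator is split off and
    Leibniz's rule applied. The truncated subtraction is harmless, since its coefficient is 0 when
    x_p does not occur. *)
Lemma commutator_monomial p e :
  commutator (A p) (monomial e) = (e p)%:R *: monomial (fun s => e s - (s == p))%N.
Proof.
have [n] := ubnP (\sum_s e s); elim: n e => // n IHn e le_en.
have [s es|e0] := pickP (fun s => e s != 0%N); last first.
  have {}e0 s : e s = 0%N by apply/eqP; rewrite -[_ == _]negbK e0.
  rewrite e0 scale0r (@eq_monomial _ (fun=> 0%N)) // monomial0.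
  by apply: commutator_comm; apply: commr1.
pose f s' := (e s' - (s' == s))%N.
have ef s' : e s' = ((s' == s) + f s')%N.
  by rewrite /f; case: eqP => [->|]; rewrite ?subn0 // subnKC // lt0n.
rewrite (eq_monomial ef) monomialD monomial1 commutator_mulr IHn; last first.
  move: le_en; under eq_bigr => i _ do rewrite ef.
  by rewrite big_split /= (bigD1 s) //= eqxx add1n addSn ltnS; apply/leq_trans/leq_addl.
have [-> _ _] := ccrA p s; rewrite -op_scalerAr -[Ac s](monomial1 s) -monomialD.
rewrite ef; have [->|ps] := eqVneq p s; last first.
  rewrite mul0r add0r add0n.
  have [->|fp] := eqVneq (f p) 0%N; first by rewrite !scale0r.
  congr (_ *: _); apply: eq_monomial => s'; rewrite ef.
  by have [->|_] := eqVneq s' p; rewrite ?(negPf ps) ?subn0.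
rewrite mul1r natrD scalerDl scale1r; congr (_ + _).
have [->|fs] := eqVneq (f s) 0%N; first by rewrite !scale0r.
congr (_ *: _); apply: eq_monomial => s'; rewrite ef.
by have [->|_] := eqVneq s' s; rewrite ?subn0 // addKn subnKC // lt0n.
Qed.

(** This is the Lie bracket of two vector fields: the second-order parts cancel because annihilation
    operators commute and monomials commute. Exponents are truncated only where the coefficient is
    0. *)
Lemma commutator_term e f p q :
  commutator (field_term e q) (field_term f p)
  = (f q)%:R *: field_term (fun s => e s + f s - (s == q))%N p
    - (e p)%:R *: field_term (fun s => e s + f s - (s == p))%N q.
Proof.
have half e1 f1 p1 q1 : (f1 q1)%:R *: field_term (fun s => e1 s + f1 s - (s == q1))%N p1
    = monomial e1 * commutator (A q1) (monomial f1) * A p1.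
  rewrite commutator_monomial -op_scalerAr -op_scalerAl /field_term.
  have [->|f1q] := eqVneq (f1 q1) 0%N; first by rewrite !scale0r.
  rewrite -monomialD; congr (_ *: _); congr (_ * _); apply: eq_monomial => s.
  by rewrite addnBA //; case: eqP => // ->; rewrite lt0n.
rewrite half.
rewrite [X in _ - _ *: field_term X _](_ : _ = fun s => f s + e s - (s == p))%N.
  rewrite half /commutator /field_term; have [_ /subr0_eq Aqp _] := ccrA q p.
  rewrite !mulrBr !mulrBl !mulrA opprB [monomial f * monomial e]comm_monomial.
  by rewrite -!mulrA Aqp addrA subrK.
by apply/funext => s; rewrite addnC.
Qed.

(** Bracketing with x_p applies the field to the coordinate x_p, that is, reads off its coefficient
    at d/dx_p. *)
Lemma commutator_term_creation e p q :
  commutator (field_term e q) (Ac p) = if q == p then monomial e else 0.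
Proof.
rewrite commutatorC commutator_mulr [X in X * _ + _]commutator_comm; last first.
  by rewrite -monomial1; apply: comm_monomial.
have [qp _ _] := ccrA q p; rewrite commutatorC in qp.
by rewrite mul0r add0r -mulrN qp; case: eqP; rewrite ?mulr1 ?mulr0.
Qed.

(** [C e q] constrains the monomial [e] and the direction [q] of a term x^e d/dx_q. Bounds on
    degree, divisibility by certain variables and triangularity all become choices of [C]. *)
Inductive field_span C : op -> Prop :=
| field_span0 : field_span C 0
| field_span_cons a e q W :
    C e q -> field_span C W -> field_span C (a *: field_term e q + W).

Lemma field_spanD C W1 W2 :
  field_span C W1 -> field_span C W2 -> field_span C (W1 + W2).
Proof.
move=> spW1 spW2; elim: spW1 => [|a e q W Ceq _ IH]; first by rewrite add0r.
by rewrite -addrA; apply: field_span_cons.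
Qed.

Lemma field_spanZ C a W : field_span C W -> field_span C (a *: W).
Proof.
elim=> [|b e q W1 Ceq _ IH]; first by rewrite scaler0; left.
by rewrite scalerDr scalerA; right.
Qed.

Lemma field_spanN C W : field_span C W -> field_span C (- W).
Proof. by rewrite -scaleN1r; apply: field_spanZ. Qed.

Lemma field_span_term C a e q : C e q -> field_span C (a *: field_term e q).
Proof. by move=> Ceq; rewrite -[X in field_span C X]addr0; right=> //; left. Qed.

Lemma field_span_sum (I : Type) (r : seq I) (P : pred I) (F : I -> op) C :
  (forall i, P i -> field_span C (F i)) -> field_span C (\sum_(i <- r | P i) F i).
Proof. by move=> CF; apply: big_ind => //; [left|apply: field_spanD]. Qed.

Lemma field_span_sub C1 C2 W :
  (forall e q, C1 e q -> C2 e q) -> field_span C1 W -> field_span C2 W.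
Proof. by move=> C12; elim=> [|a e q W1 /C12 Ceq _ IH]; [left|right]. Qed.

Lemma commutator0l W : commutator 0 W = 0 :> op.
Proof. by rewrite /commutator mul0r mulr0 subrr. Qed.

(** By bilinearity only brackets of terms matter, and [C3] has to be checked only where the
    differentiated variable really occurs. *)
Lemma field_span_commutator C1 C2 C3 W1 W2 :
    (forall e q f p, C1 e q -> C2 f p -> (0 < f q)%N ->
       C3 (fun s => e s + f s - (s == q))%N p) ->
    (forall e q f p, C1 e q -> C2 f p -> (0 < e p)%N ->
       C3 (fun s => e s + f s - (s == p))%N q) ->
  field_span C1 W1 -> field_span C2 W2 -> field_span C3 (commutator W1 W2).
Proof.
move=> C123 C213 spW1 spW2; elim: spW1 => [|a e q W Ceq _ IHW].
  by rewrite commutator0l; left.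
rewrite commutator_linear_l; apply/field_spanD/IHW/field_spanZ.
elim: spW2 => [|b f p W' Cfp _ IHW2].
  by rewrite commutatorC commutator0l oppr0; left.
rewrite commutator_linear_r; apply/field_spanD/IHW2/field_spanZ.
rewrite commutator_term; apply/field_spanD; last apply/field_spanN.
  have [->|] := posnP (f q); first by rewrite scale0r; left.
  by move=> fq; apply/field_span_term/C123.
have [->|] := posnP (e p); first by rewrite scale0r; left.
by move=> ep; apply/field_span_term/C213.
Qed.

Lemma field_span_creation C p W :
    (forall e q, C e q -> q != p) ->
  field_span C W -> commutator W (Ac p) = 0.
Proof.
move=> Cp; elim=> [|a e q W1 /Cp qp _ IH]; first exact: commutator0l.
by rewrite commutator_linear_l IH commutator_term_creation (negPf qp) scaler0 addr0.
Qed.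

Lemma field_span_false C W :
  (forall e q, ~ C e q) -> field_span C W -> W = 0.
Proof. by move=> nC [//|a e q W1 /nC]. Qed.

End PolynomialFields.


(** * Direct descendants in a Hall basis *)

Section Graft.
Variable T : eqType.
Implicit Types (s t w : btree T) (u : seq (btree T)).

(** The list [u] holds the right factors added to [s], the outermost first, matching the order of
    [right_factors]. *)
Definition graft s u : btree T := foldr (fun w t => Node t w) s u.

Lemma left_factorsP s t :
  reflect (exists u, t = graft s u) (s \in t :: left_factors t).
Proof.
elim: t => [x|t1 IH w _].
  rewrite mem_seq1; apply: (iffP eqP) => [->|[[|w u] //= ->] //].
  by exists [::].
rewrite inE; apply: (iffP orP) => [[/eqP <-|/IH[u ->]]|[[|w' u] /=]].
- by exists [::].
- by exists (w :: u).
- by move=> ->; left.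
- by case=> t1u _; right; apply/IH; exists u.
Qed.

Lemma right_factors_graft s u : right_factors (graft s u) = u ++ right_factors s.
Proof. by elim: u => //= w u ->. Qed.

Lemma graft_rcons s u w : graft s (rcons u w) = graft (Node s w) u.
Proof. by rewrite /graft -cats1 foldr_cat. Qed.

Lemma tree_length_gt0 t : (0 < tree_length t)%N.
Proof. by elim: t => //= t1 t1_gt0 t2 _; rewrite addn_gt0 t1_gt0. Qed.

Lemma tree_length_graft s u :
  tree_length (graft s u) = (\sum_(w <- u) tree_length w + tree_length s)%N.
Proof.
elim: u => [|w u IH] /=; first by rewrite big_nil.
by rewrite big_cons IH addnC addnA.
Qed.

End Graft.

Section HallCombinatorics.
Variables (M r v : nat) (H : v.-tuple (btree 'I_M)).
Hypothesis hallH : hall_basis r H.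
Implicit Types (t w : btree 'I_M) (u : seq (btree 'I_M)).
Implicit Types (i j k l p q s : 'I_v) (e f : 'I_v -> nat).

(** The default 0 for a letter leaves no variable before it, so a letter carries no error term. *)
Definition right_index t : nat := if t is Node _ w then index w H else 0.

Lemma hall_node t w : Node t w \in H ->
  [/\ t \in H, w \in H, (index w H < index t H)%N & (right_index t <= index w H)%N].
Proof.
by case: hallH => _ _ _ hallE; rewrite hallE => /and5P[_ -> -> ->]; case: t.
Qed.

(** Condition (2) of the Hall rule, applied at each nesting level, makes the right factors weakly
    decrease from the outside in. *)
Lemma hall_graft t0 u : graft t0 u \in H ->
  [/\ t0 \in H, {subset u <= H} &
      sorted (fun t w => index w H <= index t H)%N u].
Proof.
elim: u => [//|w u IH] /= /hall_node[/IH[sH uH u_sorted] wH _ le_w].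
split=> // [t|]; first by rewrite inE => /predU1P[->|/uH].
by case: u {IH uH} u_sorted le_w => //= t u -> ->.
Qed.

Lemma index_tnth i : index (tnth H i) H = i.
Proof.
by case: hallH => uH _ _ _; rewrite (tnth_nth (tnth H i)) index_uniq // size_tuple.
Qed.

Lemma tnth_inj i j : (tnth H i == tnth H j) = (i == j).
Proof.
apply/eqP/eqP => [|-> //] ij; apply/val_inj.
by rewrite /= -(index_tnth i) ij index_tnth.
Qed.

Definition len i : nat := tree_length (tnth H i).

Lemma len_gt0 i : (0 < len i)%N.
Proof. exact: tree_length_gt0. Qed.

Lemma len_le i : (0 < r)%N -> (len i <= r)%N.
Proof.
case: hallH => _ _ _ hallE r_gt0; rewrite /len.
by have := mem_tnth i H; rewrite hallE; case: (tnth H i) => //= t w /and5P[].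
Qed.

Lemma leq_len i j : (i <= j)%N -> (len i <= len j)%N.
Proof.
case: hallH => _ sH _ _ ij; have t0 := tnth H i.
have sz k : (k < size [seq tree_length t | t <- H])%N by rewrite size_map size_tuple.
have := sorted_leq_nth leq_trans leqnn 0%N sH (i : nat) (j : nat) (sz i) (sz j) ij.
by rewrite !(nth_map t0) ?size_tuple // -!tnth_nth.
Qed.

Lemma ltn_len i j : (len i < len j)%N -> (i < j)%N.
Proof. by apply: contraLR; rewrite -!leqNgt; apply: leq_len. Qed.

(** In [t, w] the factor w precedes t, and t precedes [t, w] because it is shorter. *)
Lemma right_index_leq i : (right_index (tnth H i) <= i)%N.
Proof.
case def_i: (tnth H i) => [//|t w] /=; have := mem_tnth i H; rewrite def_i.
move=> /hall_node[/tnthP[j def_t] _ /ltnW lt_wt _]; apply: leq_trans lt_wt _.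
rewrite def_t index_tnth; apply/ltnW/ltn_len.
by rewrite /len def_i /= def_t -addn1 leq_add2l tree_length_gt0.
Qed.

Definition weight e : nat := \sum_(s < v) e s * len s.

Lemma weight0 : weight (fun=> 0%N) = 0%N.
Proof. by rewrite /weight big1. Qed.

Lemma weightD e f : weight (fun s => e s + f s)%N = (weight e + weight f)%N.
Proof. by rewrite /weight -big_split; apply: eq_bigr => s _; rewrite mulnDl. Qed.

Lemma weight1 q : weight (fun s => s == q) = len q.
Proof.
rewrite /weight (bigD1 q) //= eqxx mul1n big1 ?addn0 // => s /negPf->.
by rewrite mul0n.
Qed.

Lemma weightB e q :
  (0 < e q)%N -> (weight (fun s => e s - (s == q))%N + len q = weight e)%N.
Proof.
move=> eq_gt0; rewrite -weight1 -weightD; apply: eq_bigr => s _.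
by rewrite subnK //; case: eqP => [->|].
Qed.

Lemma weight_gt0 e p : (0 < e p)%N -> (0 < weight e)%N.
Proof.
by move=> ep; rewrite /weight (bigD1 p) //= addn_gt0 muln_gt0 ep len_gt0.
Qed.

Lemma weight_count u : {subset u <= H} ->
  weight (fun s => count_mem (tnth H s) u) = (\sum_(w <- u) tree_length w)%N.
Proof.
elim: u => [|w u IH] uH; first by rewrite big_nil weight0.
rewrite big_cons -IH => [|t tu]; last by rewrite uH // inE tu orbT.
have /tnthP[i ->] : w \in H by rewrite uH // mem_head.
rewrite -[tree_length _]weight1 -weightD; apply: eq_bigr => s _ /=.
by rewrite tnth_inj eq_sym.
Qed.

(** Reflexive closure of direct descent: the leading term A_l becomes the summand j = l. *)
Definition descends l j : bool := tnth H l \in tnth H j :: left_factors (tnth H j).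

Definition hall_exponent l j s : nat := (hall_mult H j s - hall_mult H l s)%N.

(** The right factors of H_l form a suffix of those of H_j, so the truncated difference is a true
    one and counts the factors added. *)
Lemma hall_exponent_graft l j u : tnth H j = graft (tnth H l) u ->
  hall_exponent l j = fun s => count_mem (tnth H s) u.
Proof.
move=> def_j; apply/funext => s.
by rewrite /hall_exponent /hall_mult def_j right_factors_graft count_cat addnK.
Qed.

Lemma hall_depth_graft l j u : tnth H j = graft (tnth H l) u ->
  (hall_depth H j - hall_depth H l = size u)%N.
Proof.
by move=> def_j; rewrite /hall_depth def_j right_factors_graft size_cat addnK.
Qed.

Lemma descends_graft l j : descends l j ->
  exists u, [/\ tnth H j = graft (tnth H l) u, {subset u <= H} &
                sorted (fun t w => index w H <= index t H)%N u].
Proof.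
move=> /left_factorsP[u def_j]; exists u; split=> //;
by have /hall_graft[] : graft (tnth H l) u \in H by rewrite -def_j mem_tnth.
Qed.

(** Grafting adds the lengths of the new right factors, which [weight] sums up. Hence every term of
    E_l has degree -length(H_l). *)
Lemma weight_exponent l j : descends l j ->
  (weight (hall_exponent l j) + len l = len j)%N.
Proof.
move=> /descends_graft[u [def_j uH _]].
by rewrite (hall_exponent_graft def_j) weight_count // /len def_j tree_length_graft.
Qed.

Lemma descends_refl l : descends l l.
Proof. exact: mem_head. Qed.

(** The innermost added factor w works: [H_l, w] is itself a Hall element, so w precedes H_l. *)
Lemma descends_proper l j : descends l j -> j != l ->
  exists2 p : 'I_v, (p < l)%N & (0 < hall_exponent l j p)%N.
Proof.
move=> /descends_graft[u [def_j uH _]] jl.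
case/lastP: u => [|u w] in def_j uH *; first by rewrite -tnth_inj def_j eqxx in jl.
have /tnthP[p def_w] : w \in H by rewrite uH // mem_rcons mem_head.
exists p; last first.
  by rewrite (hall_exponent_graft def_j) -has_count has_pred1 mem_rcons -def_w mem_head.
have : graft (Node (tnth H l) w) u \in H by rewrite -graft_rcons -def_j mem_tnth.
by case/hall_graft => /hall_node[_ _ + _] _ _; rewrite def_w !index_tnth.
Qed.

Section Bracket.
Variables i j k : 'I_v.
Hypothesis def_i : tnth H i = Node (tnth H j) (tnth H k).

Lemma bracket_ltn : (k < j)%N.
Proof.
have := mem_tnth i H; rewrite def_i => /hall_node[_ _ + _].
by rewrite !index_tnth.
Qed.

Lemma descends_bracket l : descends i l ->
  exists2 u, tnth H l = graft (tnth H i) u &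
             tnth H l = graft (tnth H j) (rcons u (tnth H k)).
Proof. by case/left_factorsP=> u def_l; exists u; rewrite // graft_rcons -def_i. Qed.

Lemma descends_bracketl l : descends i l -> descends j l.
Proof.
by case/descends_bracket=> u _ def_l; apply/left_factorsP; exists (rcons u (tnth H k)).
Qed.

(* The right factors weakly decrease from the outside in, so if none of those added to
   H_j precedes H_k and H_k is one of them, then H_k is the innermost one. *)
Lemma descends_bracketr l : descends j l -> (0 < hall_exponent j l k)%N ->
  (forall p, (p < k)%N -> hall_exponent j l p = 0%N) -> descends i l.
Proof.
move=> /descends_graft[u [def_l uH u_sorted]]; rewrite (hall_exponent_graft def_l).
case/lastP: u => [//|u w] in def_l uH u_sorted *.
rewrite -has_count has_pred1 => ku e0; apply/left_factorsP; exists u.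
rewrite def_l graft_rcons def_i; congr (graft (Node _ _) _).
have /tnthP[p def_w] : w \in H by rewrite uH // mem_rcons mem_head.
rewrite {}def_w in def_l uH u_sorted ku e0 *; congr tnth; apply/val_inj/eqP.
rewrite eqn_leq; apply/andP; split=> /=; last first.
  rewrite leqNgt; apply/negP => /e0 /eqP; rewrite -leqn0 leqNgt -has_count has_pred1.
  by rewrite mem_rcons mem_head.
move: ku; rewrite mem_rcons inE tnth_inj => /predU1P[-> //|ku].
have R_trans : transitive (fun t w => index w H <= index t H)%N.
  by move=> t1 t2 t3 t12 t31; apply: leq_trans t31 t12.
move: u_sorted; rewrite -cats1 (sorted_pairwise R_trans) pairwise_cat.
by case/and3P=> /allP/(_ _ ku); rewrite /= andbT !index_tnth.
Qed.

(** Seen from H_j, a descendant of H_i = [H_j, H_k] has exactly one more right factor, namely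
    H_k. *)
Lemma hall_exponent_bracket l : descends i l ->
  [/\ (0 < hall_exponent j l k)%N,
      hall_exponent i l = (fun s => hall_exponent j l s - (s == k))%N &
      (hall_depth H l - hall_depth H j = (hall_depth H l - hall_depth H i).+1)%N].
Proof.
case/descends_bracket=> u def_l def_l'.
rewrite (hall_depth_graft def_l) (hall_depth_graft def_l') size_rcons.
rewrite (hall_exponent_graft def_l) (hall_exponent_graft def_l'); split=> //.
  by rewrite -has_count has_pred1 mem_rcons mem_head.
by apply/funext => s; rewrite -cats1 count_cat /= addn0 tnth_inj [k == s]eq_sym addnK.
Qed.

Lemma len_bracket : len i = (len j + len k)%N.
Proof. by rewrite /len def_i. Qed.

End Bracket.

(** A tree is longer than each of its left factors, so it is never one of them. *)
Lemma descends_direct l j : descends l j && (j != l) = direct_descendant H l j.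
Proof.
rewrite /descends /direct_descendant inE tnth_inj andb_orl [l == j]eq_sym andbN /=.
apply: andb_idr => lj; apply/negP => /eqP def_j; rewrite def_j in lj.
suff lt_left t t' : t' \in left_factors t -> (tree_length t' < tree_length t)%N.
  by have := lt_left _ _ lj; rewrite ltnn.
elim: t => //= t IH w _; rewrite inE => /predU1P[->|/IH lt_st].
  by rewrite -[X in (X < _)%N]addn0 ltn_add2l tree_length_gt0.
exact: leq_trans lt_st (leq_addr _ _).
Qed.

End HallCombinatorics.


(** * The vector fields of the Hall basis *)

Section HallFields.
Variables (K : numFieldType) (D : lmodType K) (M r v : nat).
Variables (H : v.-tuple (btree 'I_M)) (A Ac : 'I_v -> operator D).
Hypothesis ccrA : ccr A Ac.
Hypothesis hallH : hall_basis r H.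
Implicit Types (i j k l p q s : 'I_v) (e f : 'I_v -> nat) (n m : nat).
Implicit Types (W : operator D).
Local Notation span := (field_span A Ac).
Local Notation term := (field_term A Ac).

(** The formula for E_l, extended from the generators to every Hall element. *)
Definition hall_field l : operator D :=
  \sum_(j < v | descends H l j) hall_coef K H j l *: term (hall_exponent H l j) j.

(** Terms of degree -n whose coefficient lies in the ideal generated by the variables x_p with p <
    m. *)
Definition ideal_term n m e q : Prop :=
  (weight H e + n)%N = len H q /\ exists2 p : 'I_v, (p < m)%N & (0 < e p)%N.

Definition leading_term j e q : Prop :=
  (weight H e + len H j)%N = len H q /\ (j <= q)%N.

(** A nonconstant coefficient has positive weight, so H_q is longer than H_j and comes later. *)
Lemma ideal_term_ltn j m e q : ideal_term (len H j) m e q -> (j < q)%N.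
Proof.
move=> [wt_e [p _ /(weight_gt0 H) e_gt0]]; apply: (ltn_len hallH).
by rewrite -wt_e -[X in (X < _)%N]add0n ltn_add2r.
Qed.

Lemma annihilation_term q : A q = term (fun=> 0%N) q.
Proof. by rewrite /field_term monomial0 mul1r. Qed.

Lemma hall_coef_refl l : hall_coef K H l l = 1.
Proof.
rewrite /hall_coef subnn expr0 big1 ?divr1 // => s _; by rewrite subnn.
Qed.

Lemma hall_field_tail l : span (ideal_term (len H l) l) (hall_field l - A l).
Proof.
rewrite /hall_field (bigD1 l) /=; last exact: descends_refl.
rewrite hall_coef_refl scale1r (_ : hall_exponent H l l = fun=> 0%N); last first.
  by apply/funext => s; rewrite /hall_exponent subnn.
rewrite -annihilation_term addrAC subrr add0r.
apply: field_span_sum => j /andP[lj jl]; apply: field_span_term.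
by split; [apply: (weight_exponent hallH)|apply: (descends_proper hallH)].
Qed.

Lemma hall_field_leading l : span (leading_term l) (hall_field l).
Proof.
rewrite -(subrK (A l) (hall_field l)); apply: field_spanD.
  apply: field_span_sub (hall_field_tail l) => e q Ceq; split; first by case: Ceq.
  exact/ltnW/(ideal_term_ltn Ceq).
rewrite annihilation_term -[X in span _ X]scale1r; apply: field_span_term.
by split=> //; rewrite weight0.
Qed.

Lemma hall_operatorE l : hall_operator H A Ac l = hall_field l.
Proof.
rewrite /hall_operator; have [l0|_] := ifP.
  (* For the first generator the tail is empty: each of its terms would need a variable before
     x_1. *)
  apply/esym/eqP; rewrite -subr_eq0; apply/eqP.
  apply: field_span_false (hall_field_tail l) => e q [_ [p]].
  by rewrite (eqP l0).
rewrite /hall_field [RHS](bigD1 l) /=; last exact: descends_refl.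
rewrite hall_coef_refl scale1r (_ : hall_exponent H l l = fun=> 0%N); last first.
  by apply/funext => s; rewrite /hall_exponent subnn.
rewrite -annihilation_term; congr (_ + _).
by apply: eq_bigl => j; rewrite (descends_direct hallH).
Qed.

Lemma commutator_term_annihilation e q k :
  commutator (term e q) (A k) = - ((e k)%:R *: term (fun s => e s - (s == k))%N q).
Proof.
rewrite annihilation_term commutator_term // scale0r sub0r.
by congr (- (_ *: field_term _ _ _ _)); apply/funext => s; rewrite addn0.
Qed.

Lemma commutator_suml (I : Type) (s : seq I) (P : pred I) (F : I -> operator D) W :
  commutator (\sum_(i <- s | P i) F i) W = \sum_(i <- s | P i) commutator (F i) W.
Proof. by rewrite /commutator mulr_suml mulr_sumr -sumrB. Qed.

Lemma commutatorZl a W1 W : commutator (a *: W1) W = a *: commutator W1 W.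
Proof. by rewrite /commutator -op_scalerAl -op_scalerAr -scalerBr. Qed.

Lemma commutatorBl W1 W2 W : commutator (W1 - W2) W = commutator W1 W - commutator W2 W.
Proof.
by rewrite /commutator mulrBl mulrBr !opprB addrACA [RHS]addrACA [- _ - _]addrC.
Qed.

Lemma commutatorDr W W1 W2 : commutator W (W1 + W2) = commutator W W1 + commutator W W2.
Proof. by rewrite /commutator mulrDl mulrDr opprD addrACA. Qed.

Lemma prod_fact_sub1 e k : (0 < e k)%N ->
  (\prod_s (e s)`! = e k * \prod_s (e s - (s == k))`!)%N.
Proof.
move=> ek; rewrite (bigD1 k) //= [in RHS](bigD1 k) //= eqxx mulnA.
rewrite -[in LHS](prednK ek) factS prednK // subn1; congr (_ * _)%N.
by apply: eq_bigr => s /negPf->; rewrite subn0.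
Qed.

(** The depth difference drops by one, which flips the sign, and the exponent of x_k cancels against
    the factorial. *)
Lemma hall_coef_bracket i j k l : tnth H i = Node (tnth H j) (tnth H k) ->
  descends H i l ->
  hall_coef K H l j * (hall_exponent H j l k)%:R = - hall_coef K H l i.
Proof.
move=> def_i il; have [ek def_e def_d] := hall_exponent_bracket hallH def_i il.
rewrite /hall_coef def_d exprS mulN1r mulNr mulNr; congr (- _).
have -> : (\prod_s (hall_mult H l s - hall_mult H j s)`!
    = hall_exponent H j l k * \prod_s (hall_mult H l s - hall_mult H i s)`!)%N.
  rewrite [LHS](prod_fact_sub1 ek); congr (_ * _)%N; apply: eq_bigr => s _.
  by rewrite -[RHS]/((hall_exponent H i l s)`!) def_e.
rewrite natrM invfM -!mulrA [_^-1 * (_ * _)]mulrCA mulVf ?mulr1 //.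
by rewrite Num.Theory.pnatr_eq0 -lt0n.
Qed.

(** Differentiating the field of H_j along x_k turns the terms of descendants of H_i into the field
    of H_i; the other surviving terms keep a variable before x_k. *)
Lemma hall_field_bracket i j k : tnth H i = Node (tnth H j) (tnth H k) ->
  span (ideal_term (len H i) k) (commutator (hall_field j) (A k) - hall_field i).
Proof.
move=> def_i; rewrite /hall_field commutator_suml (bigID (descends H i)) /=.
rewrite [X in X + _ - _](_ : _ = hall_field i); last first.
  apply: eq_big => [l|l /andP[_ il]].
    exact/andb_idl/(descends_bracketl def_i).
  rewrite commutatorZl commutator_term_annihilation scalerN scalerA.
  rewrite (hall_coef_bracket def_i il) scaleNr opprK.
  by have [_ -> _] := hall_exponent_bracket hallH def_i il.
rewrite addrAC subrr add0r; apply: field_span_sum => l /andP[jl nil].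
rewrite commutatorZl commutator_term_annihilation scalerN scalerA; apply: field_spanN.
have [->|ek] := posnP (hall_exponent H j l k).
  by rewrite mulr0 scale0r; left.
apply: field_span_term; split.
  rewrite (len_bracket def_i) [(len H j + _)%N]addnC addnA (weightB H ek).
  exact: (weight_exponent hallH jl).
(* If no variable before x_k occurred, H_k would be the innermost added factor and H_l would descend
   from H_i. *)
have [[p /andP[pk ep]]|no_p] :=
    pselect (exists p, (p < k)%N && (0 < hall_exponent H j l p)%N).
  exists p => //; rewrite (_ : p == k = false) ?subn0 //.
  by apply/negbTE; rewrite -val_eqE neq_ltn /= pk.
case/negP: nil; apply: (descends_bracketr hallH def_i jl ek) => p pk.
apply/eqP; rewrite -leqn0 leqNgt; apply/negP => ep; apply: no_p.
by exists p; rewrite pk.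
Qed.

(** * Hall elements evaluated at the generating fields *)

Section Evaluation.
Variable gen : 'I_M -> operator D.
Hypothesis genE : forall i (x : 'I_M), tnth H i = Leaf x -> gen x = hall_field i.

(* Modulo the ideal spanned by the variables preceding the last right factor,
   brackets of generators follow the Hall basis: every proper term of the field
   of H_k involves a variable before H_k, and the fields of H_j and H_k with
   j >= k preserve the ideal of those variables. *)
Lemma tree_eval_hall i :
  span (ideal_term (len H i) (right_index H (tnth H i)))
    (tree_eval gen (tnth H i) - hall_field i).
Proof.
have [t] : {t | tnth H i = t} by exists (tnth H i).
elim: t i => [m|t IHt w IHw] i def_i.
  by rewrite def_i /= (genE def_i) subrr; left.
have [tH wH _ le_tw] : [/\ t \in H, w \in H, (index w H < index t H)%N
    & (right_index H t <= index w H)%N].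
  by apply: (hall_node hallH); rewrite -def_i mem_tnth.
have /tnthP[j def_t] := tH; have /tnthP[k def_w] := wH.
have {IHt}/= IHj := IHt j (esym def_t); have {IHw}/= IHk := IHw k (esym def_w).
rewrite def_i /=; subst t w; rewrite (index_tnth hallH) in le_tw *.
have kj := bracket_ltn hallH def_i; have lenE := len_bracket def_i.
set Wj := tree_eval gen (tnth H j) in IHj *.
set Wk := tree_eval gen (tnth H k) in IHk *.
have ideal_sub n m1 m2 W : (m1 <= m2)%N ->
    span (ideal_term n m1) W -> span (ideal_term n m2) W.
  move=> le_m; apply: field_span_sub => e q [wt_e [p pm ep]]; split=> //.
  by exists p => //; apply: leq_trans pm le_m.
(* Here condition (2) of the Hall rule enters: the last right factor of H_j does not come after
   H_k. *)
have {}IHj := ideal_sub _ _ k _ le_tw IHj.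
have tail_k : span (ideal_term (len H k) k) (Wk - A k).
  rewrite -(subrK (hall_field k) Wk) -addrA.
  apply: field_spanD (hall_field_tail k).
  by apply: ideal_sub (right_index_leq hallH k) IHk.
have lead_j : span (leading_term j) Wj.
  rewrite -(subrK (hall_field j) Wj); apply/field_spanD/hall_field_leading.
  apply: field_span_sub IHj => e q Ceq; split; first by case: Ceq.
  exact/ltnW/(ideal_term_ltn Ceq).
(* Three errors remain: that of the exact bracket, that of [Wj], and that of replacing [Wk] by
   d/dx_k. *)
have -> : bracket Wj Wk - hall_field i
    = (commutator (hall_field j) (A k) - hall_field i)
      + commutator (Wj - hall_field j) (A k) + commutator Wj (Wk - A k).
  rewrite -[X in bracket _ X](subrK (A k)) -[bracket _ _]/(commutator _ _).
  rewrite commutatorDr commutatorBl -[LHS]addrA [LHS]addrC; congr (_ + _).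
  by rewrite [RHS]addrC addrA subrK.
apply: field_spanD; first apply: field_spanD; first exact: hall_field_bracket.
  apply: (field_span_commutator ccrA (C2 := fun f p => p = k /\ f = fun=> 0%N)) IHj _.
  - by move=> e q f p _ [_ ->].
  - move=> e q f p [wt_e [p0 p0k ep0]] [-> ->] ek; split.
      have -> : (fun s => e s + 0 - (s == k))%N = (fun s => e s - (s == k))%N.
        by apply/funext => s; rewrite addn0.
      by rewrite lenE [(len H j + _)%N]addnC addnA (weightB H ek).
    by exists p0; rewrite // addn0 -val_eqE /= (ltn_eqF p0k) subn0.
  - rewrite annihilation_term -[X in field_span _ _ _ X]scale1r.
    exact: field_span_term.
(* The tail of [Wk] contains some x_p with p < k, while all directions occurring on either side come
   after k; the factor x_p is never differentiated away. *)
apply: (field_span_commutator ccrA) lead_j tail_k.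
- move=> e q f p [wt_e jq] [wt_f [p0 p0k fp0]] fq; split.
    apply/eqP; rewrite -(eqn_add2r (len H q)) addnAC.
    rewrite (weightB H (e := fun s => _)); last first.
      by rewrite addn_gt0 fq orbT.
    rewrite weightD lenE -wt_f -wt_e; lia.
  exists p0 => //; rewrite -val_eqE /= (ltn_eqF _) ?subn0 ?addn_gt0 ?fp0 ?orbT //.
  exact: leq_trans p0k (leq_trans (ltnW kj) jq).
move=> e q f p [wt_e jq] Cf ep; have kp := ideal_term_ltn Cf.
case: Cf => wt_f [p0 p0k fp0]; split.
  apply/eqP; rewrite -(eqn_add2r (len H p)) addnAC.
  rewrite (weightB H (e := fun s => _)); last first.
    by rewrite addn_gt0 ep.
  rewrite weightD lenE -wt_f -wt_e; lia.
exists p0 => //; rewrite -val_eqE /= (ltn_eqF _) ?subn0 ?addn_gt0 ?fp0 ?orbT //.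
exact: ltn_trans p0k kp.
Qed.

Lemma tree_eval_leading i : span (fun _ q => i < q)%N (tree_eval gen (tnth H i) - A i).
Proof.
rewrite -(subrK (hall_field i) (tree_eval _ _)) -addrA.
apply: field_spanD.
  by apply: field_span_sub (tree_eval_hall i) => e q /ideal_term_ltn.
by apply: field_span_sub (hall_field_tail i) => e q /ideal_term_ltn.
Qed.

(** Triangularity: bracketing with x_i kills the summands j > i, induction kills those with j < i,
    and c_i times the identity is left. A nonzero vector of [D] then gives c_i = 0. *)
Lemma tree_eval_hall_free (c : 'I_v -> K) : (exists x : D, x != 0) ->
  \sum_i c i *: tree_eval gen (tnth H i) = 0 -> forall i, c i = 0.
Proof.
move=> [x x0] sum0 i; have [n] := ubnP (val i).
elim: n i => // n IHn i; rewrite ltnS => le_in.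
have comm_i j : commutator (tree_eval gen (tnth H j)) (Ac i) =
    commutator (tree_eval gen (tnth H j) - A j) (Ac i) + (j == i)%:R.
  by rewrite commutatorBl; have [-> _ _] := ccrA j i; rewrite subrK.
have := congr1 (fun W => commutator W (Ac i)) sum0.
rewrite commutator_suml commutator0l (bigD1 i) //= big1 => [|j ji]; last first.
  have [lt_ji|le_ij] := ltnP j i.
    by rewrite (IHn j (leq_trans lt_ji le_in)) scale0r commutator0l.
  rewrite commutatorZl comm_i.
  rewrite (negPf ji) addr0.
  rewrite (field_span_creation ccrA _ (tree_eval_leading j)) ?scaler0 //.
  by move=> _ q jq; rewrite -val_eqE neq_ltn /= (leq_ltn_trans le_ij jq) orbT.
rewrite commutatorZl comm_i eqxx.
rewrite (field_span_creation ccrA _ (tree_eval_leading i)) => [|_ q iq]; last first.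
  by rewrite -val_eqE neq_ltn /= iq orbT.
rewrite add0r addr0 => /(congr1 (fun W : operator D => W x)).
rewrite op_scaleE op_oneE op_zeroE => /eqP.
by rewrite scaler_eq0 (negPf x0) orbF => /eqP.
Qed.

End Evaluation.

(** * Grading and nilpotency *)

Definition degree_term n e q : Prop := (weight H e + n <= len H q)%N.

Lemma degree_span_commutator n1 n2 W1 W2 :
    span (degree_term n1) W1 -> span (degree_term n2) W2 ->
  span (degree_term (n1 + n2)) (commutator W1 W2).
Proof.
apply: (field_span_commutator ccrA) => e q f p eq fp; rewrite /degree_term in eq fp *.
  move=> fq; have := weightB H (e := fun s => (e s + f s)%N) (q := q); rewrite weightD.
  by rewrite addn_gt0 fq orbT => /(_ isT); lia.
move=> ep; have := weightB H (e := fun s => (e s + f s)%N) (q := p); rewrite weightD.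
by rewrite addn_gt0 ep => /(_ isT); lia.
Qed.

(** With an inequality in [degree_term], the operators of degree at most -1 form a subalgebra; it
    contains every Hall field. *)
Lemma lie_generated_degree (G : set (operator D)) W :
  (forall W', G W' -> exists l, W' = hall_field l) ->
  lie_generated G W -> span (degree_term 1) W.
Proof.
move=> GV; apply: (smallest_sub (X := span (degree_term 1))).
  split=> [|a W1 W2 ? ?|W1 W2 spW1 spW2]; first by left.
    by apply: field_spanD => //; apply: field_spanZ.
  apply: field_span_sub (degree_span_commutator spW1 spW2) => e q.
  by apply: leq_trans; rewrite leq_add2l.
move=> _ /GV[l ->]; apply: field_span_sub (hall_field_leading l) => e q [wt_e _].
by rewrite /degree_term -wt_e leq_add2l len_gt0.
Qed.

(** Degrees add under brackets, so a surviving term would point along some H_q longer than r. *)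
Lemma tree_eval_nilpotent T (f : T -> operator D) t : (0 < r)%N ->
  (forall x, span (degree_term 1) (f x)) -> (r < tree_length t)%N -> tree_eval f t = 0.
Proof.
move=> r_gt0 spf rt; have : span (degree_term (tree_length t)) (tree_eval f t).
  by elim: t {rt} => //= t1 IH1 t2 IH2; apply: degree_span_commutator.
apply: field_span_false => e q; apply/negP; rewrite -ltnNge.
apply: leq_ltn_trans (len_le hallH q r_gt0) (leq_trans rt (leq_addl _ _)).
Qed.

End HallFields.

(** * Dimension count and the isomorphism *)

Lemma linear_inj_free (K : fieldType) (g L : lmodType K) (v : nat)
    (psi : g -> L) (w : 'I_v -> g) :
  Vector.axiom v g -> linear psi ->
  (forall c : 'I_v -> K, \sum_i c i *: psi (w i) = 0 -> forall i, c i = 0) ->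
  injective psi.
Proof.
move=> [v2r lin_v2r bij_v2r] lin_psi free_w.
pose psil := GRing.isLinear.Build _ _ _ _ _ lin_psi.
pose psiL : {linear g -> L} := HB.pack psi psil.
pose vl := GRing.isLinear.Build _ _ _ _ _ lin_v2r.
pose vL : {linear g -> 'rV[K]_v} := HB.pack v2r vl.
have inj_v2r := bij_inj bij_v2r.
pose B : 'M[K]_v := \matrix_i v2r (w i).
have BE c : c *m B = v2r (\sum_i c 0 i *: w i).
  rewrite -[v2r _]/(vL _) linear_sum mulmx_sum_row; apply: eq_bigr => i _.
  by rewrite linearZ rowK.
have psiE (c : 'I_v -> K) : psi (\sum_i c i *: w i) = \sum_i c i *: psi (w i).
  by rewrite -[psi _]/(psiL _) linear_sum; apply: eq_bigr => i _; rewrite linearZ.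
(* Independent images force independent [w i]. There are as many of them as the dimension, so their
   coordinate matrix is square and invertible, and they form a basis. *)
have B_unit : B \in unitmx.
  rewrite -row_free_unit; apply: inj_row_free => c; rewrite BE => cB0.
  apply/rowP => i; rewrite mxE; apply: (free_w (c 0)); rewrite -psiE.
  have -> : \sum_i c 0 i *: w i = 0.
    by apply: inj_v2r; rewrite cB0 -[RHS]/(vL 0) linear0.
  exact: (linear0 psiL).
suff psi0 x : psi x = 0 -> x = 0.
  move=> x y xy; apply/eqP; rewrite -subr_eq0; apply/eqP/psi0.
  by rewrite -[psi _]/(psiL (x - y)) linearB /= xy subrr.
have -> : x = \sum_i (v2r x *m invmx B) 0 i *: w i.
  by apply: inj_v2r; rewrite -BE mulmxKV.
rewrite psiE => /free_w c0; by rewrite big1 // => i _; rewrite c0 scale0r.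
Qed.

Theorem theorem4p3 (K : numFieldType) (r M v : nat)
    (g : lieAlgType K) (F : 'I_M -> g)
    (H : v.-tuple (btree 'I_M))
    (D : lmodType K) (A Ac : 'I_v -> operator D) :
  (1 <= r)%N -> (2 <= M)%N ->
  free_nilpotent r F ->
  Vector.axiom v g ->
  hall_basis r H ->
  (exists x : D, x != 0) ->
  ccr A Ac ->
  lie_isomorphic_onto g
    (lie_generated [set hall_operator H A Ac l | l in [set l : 'I_v | (l < M)%N]]).
Proof.
move=> r_gt0 _ [genF _ univF] dim_g hallH D0 ccrA.
set G := [set _ | _ in _].
have [_ _ takeH _] := hallH.
have le_Mv : (M <= v)%N.
  have := congr1 size takeH; rewrite size_map size_enum_ord size_take size_tuple.
  by case: ltnP => [/ltnW //|_ ->].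
pose letter (m : 'I_M) : 'I_v := widen_ord le_Mv m.
have leafE m : tnth H (letter m) = Leaf m.
  rewrite (tnth_nth (Leaf m)) -(nth_take _ (ltn_ord m)) takeH.
  by rewrite (nth_map m) ?size_enum_ord // nth_ord_enum.
pose gen m := hall_operator H A Ac (letter m).
have genG m : G (gen m) by exists (letter m) => //=.
have genE i m : tnth H i = Leaf m -> gen m = hall_field H A Ac i.
  rewrite /gen -leafE => /eqP; rewrite (tnth_inj hallH) => /eqP ->.
  exact: (hall_operatorE _ _ hallH).
have subG := lie_generated_subalgebra G.
have Ggen m : lie_mem subG (gen m).
  by apply/asboolP; apply: sub_gen_smallest; apply: genG.
(* Universality needs a Lie algebra as target, so the generated subalgebra becomes one; the
   inclusion is composed afterwards. *)
pose N := lie_sub subG.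
have nilN : nilpotent_of_step r N.
  move=> t rt; apply: val_inj.
  rewrite lie_evalE (lie_hom_tree_eval _ _ (lie_sub_val_hom subG)).
  rewrite [RHS]/=; apply: (tree_eval_nilpotent ccrA hallH) rt => // x.
  apply: (lie_generated_degree ccrA hallH _ (lie_subP x)) => _ [l _ <-].
  by exists l; apply: (hall_operatorE _ _ hallH).
have [phi [[hom_phi phiF] _]] := univF N (fun m => Sub (gen m) (Ggen m)) nilN.
pose psi : g -> operator D := val \o phi.
have hom_psi : lie_hom psi := lie_hom_comp (lie_sub_val_hom subG) hom_phi.
have psiF : psi \o F = gen by apply/funext => m; rewrite /psi /= phiF SubK.
exists psi; split=> //; split=> [x _|x y _ _|y Gy].
- exact: lie_subP.
(* The vectors are the Hall elements of g; [psi] sends them to the same brackets of the operators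
   E_l. *)
- apply: (linear_inj_free (w := fun i => tree_eval F (tnth H i)) dim_g hom_psi.1) => c.
  under eq_bigr => i _ do rewrite (lie_hom_tree_eval _ _ hom_psi) psiF.
  exact: (tree_eval_hall_free ccrA hallH genE D0).
(* The image is a subalgebra containing every E_l, hence all that they generate. *)
- move: y Gy; apply: smallest_sub; first exact: lie_hom_image.
  move=> _ [l lM <-]; exists (F (Ordinal lM)) => //.
  rewrite -[LHS]/((psi \o F) _) psiF /gen; congr hall_operator; exact: val_inj.
Qed.
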